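(* Let $G$ be a nilpotent group, let $n$ be a positive integer, and let $\Gamma_G\colon G^n\to G^n$ be a unimodular mapping. Then the inverse mapping of $\Gamma_G$ is also a unimodular mapping $G^n\to G^n$.
   Context: Let $G$ be a group and let $F(x_1,\dots,x_n)$ be the free group with basis $x_1,\dots,x_n$; $*$ denotes the free product and $G^n$ the $n$th direct power. A formal polynomial mapping is a tuple $\Phi=(\Phi_1,\dots,\Phi_n)\in\bigl(G*F(x_1,\dots,x_n)\bigr)^n$. It is called unimodular if the determinant of the $n\times n$ integer matrix composed of the exponent sums of $x_i$ in $\Phi_j$ equals $\pm1$. Each formal polynomial mapping $\Phi$ defines a mapping $\Phi_G\colon G^n\to G^n$ by substitution: $\Phi_G(g_1,\dots,g_n)=(\Phi_1(g_1,\dots,g_n),\dots,\Phi_n(g_1,\dots,g_n))$. A mapping $G^n\to G^n$ is called unimodular if it is of the form $\Phi_G$ for some unimodular formal polynomial mapping $\Phi$. By a known theorem of Shmelkin (every finite unimodular system of equations over a nilpotent group $G$ has a unique solution in $G$), every unimodular mapping $G^n\to G^n$ is bijective when $G$ is nilpotent, so the inverse mapping exists. *)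

(* Defs.v *)
From HB Require Import structures.
From mathcomp Require Import all_boot all_order all_algebra.
From mathcomp Require Import boolp.

Set Implicit Arguments.
Unset Strict Implicit.
Unset Printing Implicit Defensive.

Import GRing.Theory.
Import Algebra.

Local Open Scope group_scope.
Local Open Scope quotient_scope.

Lemma multiplicative1 (G H : groupType) (f : {multiplicative G -> H}) :
  f 1 = 1.
Proof. by apply: (mulgI (f 1)); rewrite -gmulfM !mulg1. Qed.

Section Nilpotent.
Variable G : groupType.

Inductive generated (S : G -> Prop) : G -> Prop :=
| Gen_in x : S x -> generated S x
| Gen_one : generated S 1
| Gen_mul x y : generated S x -> generated S y -> generated S (x * y)
| Gen_inv x : generated S x -> generated S x^-1.

(* gamma_1 = G is indexed by 0, and gamma_(k+1) = [gamma_k, G]. *)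
Fixpoint lower_central (k : nat) : G -> Prop :=
  if k is k'.+1 then
    generated (fun z => exists x y, lower_central k' x /\ z = [~ x, y])
  else fun _ => True.

Definition nilpotent_group : Prop :=
  exists c : nat, forall x, lower_central c x -> x = 1.

End Nilpotent.

(* The free product G * F(x_0, ..., x_(n-1)), as words in the letters g \in G *)
(* and x_i^(+-1), modulo the congruence generated by the multiplication table *)
(* of G and the free cancellations. Lemmas fp_coefM, fp_liftC, fp_liftX and   *)
(* fp_lift_uniq give its universal property.                                  *)
Section FreeProduct.
Variables (G : groupType) (n : nat).

(* inl g is the letter g; inr (i, false) is x_i and inr (i, true) is x_i^-1. *)
Local Notation letter := (G + 'I_n * bool)%type.
Local Notation word := (seq letter).

Inductive word_equiv : word -> word -> Prop :=
| We_refl u : word_equiv u u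
| We_sym u v : word_equiv u v -> word_equiv v u
| We_trans u v w : word_equiv u v -> word_equiv v w -> word_equiv u w
| We_cat u u' v v' :
    word_equiv u u' -> word_equiv v v' -> word_equiv (u ++ v) (u' ++ v')
| We_one : word_equiv [:: inl 1] [::]
| We_mul a b : word_equiv [:: inl a; inl b] [:: inl (a * b)]
| We_cancel i e : word_equiv [:: inr (i, e); inr (i, ~~ e)] [::].

Definition word_equivb : rel word := fun u v => `[< word_equiv u v >].

Fact word_equivb_refl : reflexive word_equivb.
Proof. by move=> u; apply/asboolP; exact: We_refl. Qed.

Fact word_equivb_sym : symmetric word_equivb.
Proof. by move=> u v; apply/asboolP/asboolP; exact: We_sym. Qed.

Fact word_equivb_trans : transitive word_equivb.
Proof.
by move=> v u w /asboolP uv /asboolP vw; apply/asboolP; exact: We_trans uv vw.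
Qed.

Canonical word_equiv_rel :=
  EquivRel word_equivb word_equivb_refl word_equivb_sym word_equivb_trans.

Definition free_prod : Type := {eq_quot word_equivb}.
HB.instance Definition _ := Choice.on free_prod.
HB.instance Definition _ := EqQuotient.on free_prod.

Lemma fp_eqP (u v : word) :
  \pi_free_prod u = \pi_free_prod v <-> word_equiv u v.
Proof.
by split=> [/eqmodP/asboolP | uv] //; apply/eqmodP/asboolP.
Qed.

Lemma fp_reprP (u : word) : word_equiv (repr (\pi_free_prod u)) u.
Proof. by apply/fp_eqP; rewrite reprK. Qed.

Definition letter_inv (l : letter) : letter :=
  match l with inl a => inl a^-1 | inr (i, e) => inr (i, ~~ e) end.

Definition word_inv (u : word) : word := rev (map letter_inv u).

Lemma letter_invK : involutive letter_inv.
Proof. by case=> [a|[i e]] /=; rewrite ?invgK ?negbK. Qed.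

Lemma word_invK : involutive word_inv.
Proof. by move=> u; rewrite /word_inv map_rev revK (mapK letter_invK). Qed.

Lemma letter_inv_equivr l : word_equiv [:: l; letter_inv l] [::].
Proof.
case: l => [a|[i e]] /=; last exact: We_cancel.
by apply: We_trans (We_mul _ _) _; rewrite mulgV; exact: We_one.
Qed.

Lemma word_inv_equivr u : word_equiv (u ++ word_inv u) [::].
Proof.
elim: u => [|l u IHu] /=; first exact: We_refl.
rewrite /word_inv /= rev_cons -/(word_inv u) -cats1 catA -cat1s.
apply: We_trans (letter_inv_equivr l); rewrite -[X in word_equiv _ X]cat1s.
apply: We_cat; first exact: We_refl.
by rewrite -[X in word_equiv _ X]cat0s; apply: We_cat => //; exact: We_refl.
Qed.

Lemma word_inv_equiv u v :
  word_equiv u v -> word_equiv (word_inv u) (word_inv v).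
Proof.
move=> uv; pose w := word_inv u ++ (v ++ word_inv v).
have refl := We_refl.
apply: (We_trans (v := w)).
  rewrite -[X in word_equiv X _]cats0; apply: We_cat => //.
  exact/We_sym/word_inv_equivr.
rewrite /w catA -[X in word_equiv _ X]cat0s; apply: We_cat => //.
apply: (We_trans (v := word_inv u ++ u)).
  by apply: We_cat => //; exact: We_sym.
by rewrite -[X in _ ++ X]word_invK; exact: word_inv_equivr.
Qed.

Definition fp_one : free_prod := \pi_free_prod [::].
Definition fp_mul (p q : free_prod) : free_prod :=
  \pi_free_prod (repr p ++ repr q).
Definition fp_inv (p : free_prod) : free_prod :=
  \pi_free_prod (word_inv (repr p)).

Lemma fp_mul_pi u v :
  fp_mul (\pi_free_prod u) (\pi_free_prod v) = \pi_free_prod (u ++ v).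
Proof. by apply/fp_eqP/We_cat; exact: fp_reprP. Qed.

Lemma fp_inv_pi u : fp_inv (\pi_free_prod u) = \pi_free_prod (word_inv u).
Proof. by apply/fp_eqP/word_inv_equiv/fp_reprP. Qed.

Fact fp_mulA : associative fp_mul.
Proof.
elim/quotW=> u; elim/quotW=> v; elim/quotW=> w.
by rewrite [fp_mul (\pi v) _]fp_mul_pi [fp_mul (\pi u) (\pi v)]fp_mul_pi
  !fp_mul_pi catA.
Qed.

Fact fp_mul1g : left_id fp_one fp_mul.
Proof. by elim/quotW=> u; rewrite fp_mul_pi. Qed.

Fact fp_mulg1 : right_id fp_one fp_mul.
Proof. by elim/quotW=> u; rewrite fp_mul_pi cats0. Qed.

Fact fp_mulgV : right_inverse fp_one fp_inv fp_mul.
Proof.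
elim/quotW=> u; rewrite fp_inv_pi fp_mul_pi.
by apply/fp_eqP; exact: word_inv_equivr.
Qed.

Fact fp_mulVg : left_inverse fp_one fp_inv fp_mul.
Proof.
elim/quotW=> u; rewrite fp_inv_pi fp_mul_pi; apply/fp_eqP.
by rewrite -[X in word_equiv (_ ++ X)]word_invK; exact: word_inv_equivr.
Qed.

HB.instance Definition _ := isGroup.Build free_prod
  fp_mulA fp_mul1g fp_mulg1 fp_mulVg fp_mulgV.

Definition fp_coef (a : G) : free_prod := \pi_free_prod [:: inl a].
Definition fp_var (i : 'I_n) : free_prod := \pi_free_prod [:: inr (i, false)].

Lemma fp_coefM : {morph fp_coef : a b / a * b}.
Proof.
by move=> a b; rewrite [RHS]fp_mul_pi; apply/fp_eqP/We_sym; exact: We_mul.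
Qed.

HB.instance Definition _ := isMultiplicative.Build G free_prod fp_coef fp_coefM.

(* The homomorphism from G * F(x) extending f : G -> H and x_i |-> y i. *)
Section Lift.
Variables (H : groupType) (f : {multiplicative G -> H}) (y : 'I_n -> H).

Definition word_lift (u : word) : H :=
  \prod_(l <- u)
    match l with inl a => f a | inr (i, e) => if e then (y i)^-1 else y i end.

Definition fp_lift (p : free_prod) : H := word_lift (repr p).

Lemma word_lift_cat u v : word_lift (u ++ v) = word_lift u * word_lift v.
Proof. exact: big_cat. Qed.

Lemma word_lift_equiv u v : word_equiv u v -> word_lift u = word_lift v.
Proof.
elim=> {u v} // [u v w _ -> _ -> //|u u' v v' _ eu _ ev||a b|i e].
- by rewrite !word_lift_cat eu ev.
- by rewrite /word_lift big_seq1 big_nil multiplicative1.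
- by rewrite /word_lift !big_cons big_nil !mulg1 gmulfM.
- rewrite /word_lift !big_cons big_nil mulg1.
  by case: e => /=; rewrite ?mulgV ?mulVg.
Qed.

Lemma fp_lift_pi u : fp_lift (\pi_free_prod u) = word_lift u.
Proof. exact/word_lift_equiv/fp_reprP. Qed.

Lemma fp_liftM : {morph fp_lift : p q / p * q}.
Proof. by move=> p q; rewrite fp_lift_pi word_lift_cat. Qed.

HB.instance Definition _ := isMultiplicative.Build free_prod H fp_lift fp_liftM.

Lemma fp_liftC a : fp_lift (fp_coef a) = f a.
Proof. by rewrite fp_lift_pi /word_lift big_seq1. Qed.

Lemma fp_liftX i : fp_lift (fp_var i) = y i.
Proof. by rewrite fp_lift_pi /word_lift big_seq1. Qed.

End Lift.

Lemma fp_lift_uniq (H : groupType) (f : {multiplicative G -> H})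
    (y : 'I_n -> H) (h : {multiplicative free_prod -> H}) :
  (forall a, h (fp_coef a) = f a) -> (forall i, h (fp_var i) = y i) ->
  h =1 fp_lift f y.
Proof.
move=> hC hX p; rewrite -[p]reprK fp_lift_pi.
have hV i : h (\pi_free_prod [:: inr (i, true)]) = (y i)^-1.
  rewrite -hX; apply: (mulIg (h (fp_var i))).
  rewrite mulVg -gmulfM -(multiplicative1 h); congr (h _).
  by rewrite [LHS]fp_mul_pi; apply/fp_eqP; exact: We_cancel.
elim: (repr p) => [|l u IHu].
  by rewrite /word_lift big_nil -(multiplicative1 h).
rewrite -cat1s -fp_mul_pi gmulfM IHu word_lift_cat; congr (_ * _).
rewrite /word_lift big_seq1; case: l => [a|[i []]].
- exact: hC.
- exact: hV.
- exact: hX.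
Qed.

Section ExponentSum.
Local Open Scope ring_scope.
Variable i : 'I_n.

Definition word_expsum (u : word) : int :=
  \sum_(l <- u)
    match l with
    | inl _ => 0
    | inr (j, e) => if j == i then (if e then -1 else 1) else 0
    end.

Definition fp_expsum (p : free_prod) : int := word_expsum (repr p).

Lemma word_expsum_cat u v :
  word_expsum (u ++ v) = word_expsum u + word_expsum v.
Proof. exact: big_cat. Qed.

Lemma word_expsum_equiv u v : word_equiv u v -> word_expsum u = word_expsum v.
Proof.
elim=> {u v} // [u v w _ -> _ -> //|u u' v v' _ eu _ ev||a b|j e].
- by rewrite !word_expsum_cat eu ev.
- by rewrite /word_expsum big_seq1 big_nil.
- by rewrite /word_expsum !big_cons big_nil !addr0.
- rewrite /word_expsum !big_cons big_nil addr0.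
  by case: e; case: (j == i).
Qed.

Lemma fp_expsum_pi u : fp_expsum (\pi_free_prod u) = word_expsum u.
Proof. exact/word_expsum_equiv/fp_reprP. Qed.

Lemma fp_expsumM p q : fp_expsum (p * q)%g = fp_expsum p + fp_expsum q.
Proof. by rewrite fp_expsum_pi word_expsum_cat. Qed.

Lemma fp_expsumC a : fp_expsum (fp_coef a) = 0.
Proof. by rewrite fp_expsum_pi /word_expsum big_seq1. Qed.

Lemma fp_expsumX j : fp_expsum (fp_var j) = (j == i)%:R.
Proof. by rewrite fp_expsum_pi /word_expsum big_seq1; case: (j == i). Qed.

End ExponentSum.

End FreeProduct.

Section PolynomialMappings.
Variables (G : groupType) (n : nat).

(* Phi is a tuple in (G * F(x))^n; G^n is {ffun 'I_n -> G}. *)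
Definition formal_poly_map : Type := {ffun 'I_n -> free_prod G n}.

Definition exponent_matrix (Phi : formal_poly_map) : 'M[int]_n :=
  \matrix_(i, j) fp_expsum i (Phi j).

Definition formal_unimodular (Phi : formal_poly_map) : Prop :=
  (\det (exponent_matrix Phi) = 1 \/ \det (exponent_matrix Phi) = -1)%R.

(* Substitution is the lift of the identity of G. *)
Definition poly_map (Phi : formal_poly_map)
    (g : {ffun 'I_n -> G}) : {ffun 'I_n -> G} :=
  [ffun j => fp_lift idfun g (Phi j)].

Definition unimodular_map (Gamma : {ffun 'I_n -> G} -> {ffun 'I_n -> G}) :
    Prop :=
  exists2 Phi : formal_poly_map, formal_unimodular Phi & Gamma =1 poly_map Phi.

End PolynomialMappings.

(* Main.v *)
(* After composing with a formal map with the inverse exponent matrix, we may *)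
(* assume that Phi has exponent matrix 1. If a word p has zero exponent sums  *)
(* and the z_i lie in gamma_k, then p(yz) = p(y) modulo gamma_(k+1), because  *)
(* the z_i are central there. So a map y |-> y e(y) with zero exponent sums   *)
(* in e and values of e in gamma_k becomes, after the substitution            *)
(* y := y e(y)^-1, the identity modulo gamma_(k+1). Iterating yields a        *)
(* unimodular right inverse of Phi_G as soon as G is nilpotent. This right    *)
(* inverse has a right inverse in turn, so it is two-sided.                   *)

From HB Require Import structures.
Require Import Defs.
From mathcomp Require Import all_boot all_order all_algebra.
From mathcomp Require Import boolp.

Set Implicit Arguments.
Unset Strict Implicit.
Unset Printing Implicit Defensive.

Import GRing.Theory.
Import Algebra.

Local Open Scope group_scope.

(** Exponent matrices obey a chain rule ([exponent_matrix_comp]) and every integer matrix is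
    realised ([formal_linear]), so the linear part of a unimodular map can be inverted formally.
    What remains is a Newton-like iteration down the lower central series,
    [formal_inverse_mod_lower_central]: by [fp_lift_mul_central], a word with zero exponent sums
    does not notice central factors in its arguments, so each correction of the error gains one term
    of the series. Nilpotency makes finitely many corrections enough, and the result is still a
    formal map. *)

(** * Integer powers in a group *)

Section IntegerPowers.
Variable G : groupType.
Implicit Types (x : G) (m : int).

Definition zexpg x m : G :=
  match m with Posz k => x ^+ k | Negz k => x ^- k.+1 end.

Lemma zexpgB x (a b : nat) : zexpg x (a%:Z - b%:Z)%R = x ^+ a / x ^+ b.
Proof.
have [le_ba | lt_ab] := leqP b a; first by rewrite subzn //= expgnFr.
rewrite -opprB subzn ?(ltnW lt_ab) //.
case: (b - a)%N (subnK (ltnW lt_ab)) => [|c] <-.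
  by rewrite /= mulgV.
by rewrite -NegzE /= expgnDr invgM mulVKg.
Qed.

Lemma zexpgD x : {morph zexpg x : m1 m2 / (m1 + m2)%R >-> m1 * m2}.
Proof.
(* Differences of naturals avoid a case analysis on signs; only the commutation of powers of [x] is
   left. *)
have intB (m : int) : exists a b : nat, m = (a%:Z - b%:Z)%R.
  case: m => k; first by exists k, 0; rewrite subr0.
  by exists 0, k.+1; rewrite sub0r NegzE.
move=> m1 m2; have [a [b ->]] := intB m1; have [c [d ->]] := intB m2.
rewrite addrACA -opprD -!PoszD !zexpgB (addnC b) !expgnDr invgM -!mulgA.
congr (_ * _); rewrite !mulgA; congr (_ / _).
rewrite (_ : commute (x ^+ c) (x ^- b)) //.
exact/commuteV/commuteX2.
Qed.

Lemma commute_zexpg x1 x2 m : commute x1 x2 -> commute x1 (zexpg x2 m).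
Proof. by case: m => k cx /=; [|apply: commuteV]; apply: commuteX. Qed.

End IntegerPowers.

Lemma multiplicativeV (G H : groupType) (f : {multiplicative G -> H}) :
  {morph f : x / x^-1}.
Proof.
by move=> x; apply: (mulgI (f x)); rewrite -gmulfM !mulgV multiplicative1.
Qed.

(** * Substitution and exponent sums *)

Section Substitution.
Variables (G : groupType) (n : nat).
Local Notation FP := (free_prod G n).

Lemma fp_ind (P : FP -> Prop) :
  (forall a, P (fp_coef n a)) -> (forall i, P (fp_var G i)) ->
  (forall p q, P p -> P q -> P (p * q)) -> (forall p, P p -> P p^-1) ->
  forall p, P p.
Proof.
move=> PC PX PM PV p; rewrite -[p]reprK; elim: (repr p) => [|l u IHu].
  by have := PC 1; rewrite (multiplicative1 (fp_coef n)).
rewrite -cat1s -fp_mul_pi; apply: PM => //.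
case: l => [a|[i []]]; [exact: PC | | exact: PX].
by have := PV _ (PX i); rewrite -[(_)^-1]/(fp_inv _) fp_inv_pi.
Qed.

Lemma gmulf_fp_lift (H K : groupType) (f : {multiplicative G -> H})
    (h : {multiplicative H -> K}) (y : 'I_n -> H) p :
  h (fp_lift f y p) = fp_lift (h \o f) (h \o y) p.
Proof.
apply: (fp_lift_uniq (h := h \o fp_lift f y)) => [a|i] /=.
  by rewrite fp_liftC.
by rewrite fp_liftX.
Qed.

Lemma fp_expsum1 i : fp_expsum i (1 : FP) = 0%R.
Proof. by rewrite -(multiplicative1 (fp_coef n)) fp_expsumC. Qed.

Lemma fp_expsumV i (p : FP) : fp_expsum i p^-1 = (- fp_expsum i p)%R.
Proof.
apply/eqP; rewrite -subr_eq0 opprK -fp_expsumM mulVg; apply/eqP.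
exact: fp_expsum1.
Qed.

Lemma fp_expsum_prod I (r : seq I) (F : I -> FP) i :
  fp_expsum i (\prod_(k <- r) F k) = (\sum_(k <- r) fp_expsum i (F k))%R.
Proof. by apply: (big_morph _ (fp_expsumM i)); apply: fp_expsum1. Qed.

Lemma fp_expsum_zexpg i (p : FP) m :
  fp_expsum i (zexpg p m) = (fp_expsum i p * m)%R.
Proof.
have expn k : fp_expsum i (p ^+ k) = (fp_expsum i p * k%:Z)%R.
  elim: k => [|k IHk]; first by rewrite fp_expsum1 mulr0.
  by rewrite expgS fp_expsumM IHk -[in RHS]add1n PoszD mulrDr mulr1.
by case: m => k /=; rewrite ?fp_expsumV expn ?NegzE ?mulrN.
Qed.

Definition formal_comp (Phi Psi : formal_poly_map G n) : formal_poly_map G n :=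
  [ffun j => fp_lift (fp_coef n) Psi (Phi j)].

Lemma poly_map_comp Phi Psi :
  poly_map (formal_comp Phi Psi) =1 poly_map Phi \o poly_map Psi.
Proof.
move=> g; apply/ffunP=> j; rewrite !ffunE.
rewrite -[LHS]/((fp_lift idfun g \o fp_lift (fp_coef n) Psi) (Phi j)).
apply: fp_lift_uniq => [a|i] /=; first by rewrite !fp_liftC.
by rewrite fp_liftX ffunE.
Qed.

(** A chain rule in the abelianization. The order is reversed because column j of the matrix belongs
    to the component [Phi j]. *)
Lemma exponent_matrix_comp Phi Psi :
  exponent_matrix (formal_comp Phi Psi)
    = (exponent_matrix Psi *m exponent_matrix Phi)%R.
Proof.
apply/matrixP=> i j; rewrite !mxE ffunE.
under eq_bigr do rewrite !mxE.
elim/fp_ind: (Phi j) => [a|k|p q IHp IHq|p IHp].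
- by rewrite fp_liftC fp_expsumC big1 // => k _; rewrite fp_expsumC mulr0.
- rewrite fp_liftX (bigD1 k) //= fp_expsumX eqxx mulr1 big1 ?addr0 //.
  by move=> l lk; rewrite fp_expsumX eq_sym (negPf lk) mulr0.
- rewrite gmulfM fp_expsumM IHp IHq -big_split /=.
  by apply: eq_bigr => k _; rewrite fp_expsumM mulrDr.
- rewrite multiplicativeV fp_expsumV IHp -sumrN.
  by apply: eq_bigr => k _; rewrite fp_expsumV mulrN.
Qed.

Lemma formal_linear (A : 'M[int]_n) :
  exists Phi : formal_poly_map G n, exponent_matrix Phi = A.
Proof.
exists [ffun j => \prod_(i < n) zexpg (fp_var G i) (A i j)].
apply/matrixP=> i j; rewrite !mxE ffunE fp_expsum_prod (bigD1 i) //=.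
rewrite fp_expsum_zexpg fp_expsumX eqxx mul1r big1 ?addr0 // => k ki.
by rewrite fp_expsum_zexpg fp_expsumX (negPf ki) mul0r.
Qed.

(** Central factors can be collected at the end of the word, where only their total exponents
    matter. The target [H] and the map [f] are arbitrary so that this applies in quotients of
    [G]. *)
Lemma fp_lift_mul_central (H : groupType) (f : {multiplicative G -> H})
    (y z : 'I_n -> H) p :
  (forall i x, commute x (z i)) ->
  fp_lift f (fun i => y i * z i) p =
    fp_lift f y p * \prod_(i < n) zexpg (z i) (fp_expsum i p).
Proof.
move=> zC; pose Z (m : 'I_n -> int) := \prod_(i < n) zexpg (z i) (m i).
have ZC m x : commute x (Z m).
  by apply: commute_prod => i _; apply: commute_zexpg.
have ZD m1 m2 : Z (fun i => m1 i + m2 i)%R = Z m1 * Z m2.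
  rewrite /Z -prodgM_commute => [|i j _ _]; last exact: commute_zexpg.
  by apply: eq_bigr => i _; rewrite zexpgD.
have Z0 m : (forall i, m i = 0%R) -> Z m = 1.
  by move=> m0; rewrite /Z big1 // => i _; rewrite m0.
have ZE m1 m2 : m1 =1 m2 -> Z m1 = Z m2.
  by move=> e; apply: eq_bigr => i _; rewrite e.
rewrite -/(Z (fun i => fp_expsum i p)).
elim/fp_ind: p => [a|j|p q IHp IHq|p IHp].
- by rewrite !fp_liftC Z0 ?mulg1 // => i; rewrite fp_expsumC.
- rewrite !fp_liftX; congr (_ * _).
  rewrite /Z (big_only1 j) //= => [|k kj _].
    by rewrite fp_expsumX eqxx.
  by rewrite fp_expsumX eq_sym (negPf kj).
- rewrite !fp_liftM IHp IHq (ZE _ _ (fun i => fp_expsumM i p q)) ZD.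
  by rewrite -!mulgA; congr (_ * _); rewrite !mulgA (ZC _ (fp_lift f y q)).
- rewrite !multiplicativeV /= IHp invgM -(commuteV (ZC _ _)); congr (_ * _).
  apply: (mulgI (Z (fun i => fp_expsum i p))); rewrite mulgV -ZD Z0 // => i.
  by rewrite fp_expsumV subrr.
Qed.

End Substitution.

(** * Quotients by normal subgroups given as predicates *)

Section QuotientGroup.
Local Open Scope quotient_scope.
Variable G : groupType.

Record normal_subgroup := NormalSubgroup {
  normal_mem :> G -> Prop;
  normal1 : normal_mem 1;
  normalM : forall x y, normal_mem x -> normal_mem y -> normal_mem (x * y);
  normalV : forall x, normal_mem x -> normal_mem x^-1;
  normalJ : forall x g, normal_mem x -> normal_mem (x ^ g) }.

Variable N : normal_subgroup.

Definition coset_eq : rel G := fun x y => `[< N (x^-1 * y) >].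

Fact coset_eq_refl : reflexive coset_eq.
Proof. by move=> x; apply/asboolP; rewrite mulVg; apply: normal1. Qed.

Fact coset_eq_sym : symmetric coset_eq.
Proof.
by move=> x y; apply/asboolP/asboolP => /normalV; rewrite invgM invgK.
Qed.

Fact coset_eq_trans : transitive coset_eq.
Proof.
move=> y x z /asboolP xy /asboolP yz; apply/asboolP.
by have := normalM xy yz; rewrite -!mulgA mulVKg.
Qed.

Canonical coset_eq_rel :=
  EquivRel coset_eq coset_eq_refl coset_eq_sym coset_eq_trans.

Definition quotient_group : Type := {eq_quot coset_eq}.
HB.instance Definition _ := Choice.on quotient_group.
HB.instance Definition _ := EqQuotient.on quotient_group.

Definition coset_of (x : G) : quotient_group := \pi_quotient_group x.

Lemma coset_eqP x y : coset_of x = coset_of y <-> N (x^-1 * y).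
Proof. by split=> [/eqmodP/asboolP | xy] //; apply/eqmodP/asboolP. Qed.

Lemma coset_repr x : N ((repr (coset_of x))^-1 * x).
Proof. by apply/coset_eqP; rewrite /coset_of reprK. Qed.

Definition quotient_mul (p q : quotient_group) := coset_of (repr p * repr q).
Definition quotient_inv (p : quotient_group) := coset_of (repr p)^-1.

Lemma quotient_mul_coset x y :
  quotient_mul (coset_of x) (coset_of y) = coset_of (x * y).
Proof.
apply/coset_eqP; have := normalM (normalJ y (coset_repr x)) (coset_repr y).
set x' := repr _; set y' := repr _ => Nxy.
(* This conjugation moves the factor [y'^-1 * y] to the front, giving [y'^-1 * x'^-1 * x * y]. *)
have := normalJ (y'^-1 * y)^-1 Nxy.
by rewrite /conjg !invgM !invgK !mulgA !(mulgK, mulgVK).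
Qed.

Lemma quotient_inv_coset x : quotient_inv (coset_of x) = coset_of x^-1.
Proof.
apply/coset_eqP; have := normalJ x^-1 (normalV (coset_repr x)).
by rewrite /conjg !invgM !invgK !mulgA mulgV mul1g.
Qed.

Fact quotient_mulA : associative quotient_mul.
Proof.
elim/quotW=> x; elim/quotW=> y; elim/quotW=> z.
by rewrite -!/(coset_of _) !quotient_mul_coset mulgA.
Qed.

Fact quotient_mul1g : left_id (coset_of 1) quotient_mul.
Proof. by elim/quotW=> x; rewrite -!/(coset_of _) quotient_mul_coset mul1g. Qed.

Fact quotient_mulg1 : right_id (coset_of 1) quotient_mul.
Proof. by elim/quotW=> x; rewrite -!/(coset_of _) quotient_mul_coset mulg1. Qed.

Fact quotient_mulVg : left_inverse (coset_of 1) quotient_inv quotient_mul.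
Proof.
elim/quotW=> x.
by rewrite -!/(coset_of _) quotient_inv_coset quotient_mul_coset mulVg.
Qed.

Fact quotient_mulgV : right_inverse (coset_of 1) quotient_inv quotient_mul.
Proof.
elim/quotW=> x.
by rewrite -!/(coset_of _) quotient_inv_coset quotient_mul_coset mulgV.
Qed.

HB.instance Definition _ := isGroup.Build quotient_group quotient_mulA
  quotient_mul1g quotient_mulg1 quotient_mulVg quotient_mulgV.

Lemma coset_ofM : {morph coset_of : x y / x * y}.
Proof. by move=> x y; rewrite [RHS]quotient_mul_coset. Qed.

HB.instance Definition _ :=
  isMultiplicative.Build G quotient_group coset_of coset_ofM.

End QuotientGroup.

(** * Centrality along the lower central series *)

Section LowerCentral.
Variable G : groupType.
Implicit Types x y : G.

Lemma lower_central1 k : lower_central k (1 : G).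
Proof. by case: k => // k; exact: Gen_one. Qed.

Lemma lower_centralM k x y :
  lower_central k x -> lower_central k y -> lower_central k (x * y).
Proof. by case: k => // k; exact: Gen_mul. Qed.

Lemma lower_centralV k x : lower_central k x -> lower_central k x^-1.
Proof. by case: k => // k; exact: Gen_inv. Qed.

Lemma lower_centralJ k x g : lower_central k x -> lower_central k (x ^ g).
Proof.
elim: k x => //= k IHk ?; elim=> [_ [x [y [kx ->]]]||x y _ IHx _ IHy|x _ IHx].
- by apply: Gen_in; exists (x ^ g), (y ^ g); rewrite conjRg; split; auto.
- by rewrite conj1g; exact: Gen_one.
- by rewrite conjMg; exact: Gen_mul.
- by rewrite conjVg; exact: Gen_inv.
Qed.

Definition lower_central_normal k : normal_subgroup G :=
  NormalSubgroup (@lower_central1 k) (@lower_centralM k) (@lower_centralV k)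
    (@lower_centralJ k).

Lemma lower_central_commute k x g :
  lower_central k x ->
  commute (coset_of (lower_central_normal k.+1) g) (coset_of _ x).
Proof.
move=> kx; rewrite /commute -!coset_ofM; apply/esym/coset_eqP.
have : lower_central k.+1 [~ x, g]^-1.
  by apply/Gen_inv/Gen_in; exists x, g.
by rewrite invgR /commg /conjg invgM !mulgA.
Qed.

(** Modulo term [k.+1] the [z i] are central, and they enter the value of [p] only through powers
    with exponent zero. *)
Lemma fp_lift_mul_lower_central n k (p : free_prod G n) (y z : 'I_n -> G) :
  (forall i, fp_expsum i p = 0%R) -> (forall i, lower_central k (z i)) ->
  lower_central k.+1
    ((fp_lift idfun y p)^-1 * fp_lift idfun (fun i => y i * z i) p).
Proof.
move=> p0 kz; pose c := coset_of (lower_central_normal k.+1).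
apply/(coset_eqP (lower_central_normal k.+1)); rewrite -/c.
have cE (w : 'I_n -> G) : c (fp_lift idfun w p) = fp_lift c (c \o w) p.
  exact: gmulf_fp_lift.
rewrite !cE.
have -> : c \o (fun i => y i * z i) = (fun i => (c \o y) i * (c \o z) i).
  by apply/funext=> i; apply: coset_ofM.
rewrite fp_lift_mul_central; last first.
  move=> i; elim/quotW=> x; exact: lower_central_commute.
by rewrite big1 ?mulg1 // => i _; rewrite p0.
Qed.

End LowerCentral.

(** * Construction of the inverse map *)

Section Inverse.
Variables (G : groupType) (n : nat).
Implicit Types Phi Psi : formal_poly_map G n.

Lemma formal_unimodular_comp Phi Psi :
  formal_unimodular Phi -> formal_unimodular Psi ->
  formal_unimodular (formal_comp Phi Psi).
Proof.
rewrite /formal_unimodular exponent_matrix_comp det_mulmx.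
by move=> [->|->] [->|->]; rewrite ?mulr1 ?mulrNN ?mul1r; auto.
Qed.

Lemma formal_inverse_mod_lower_central Phi k :
  exponent_matrix Phi = 1%:M%R ->
  exists2 Psi, exponent_matrix Psi = 1%:M%R &
    forall (y : {ffun 'I_n -> G}) j, lower_central k
      ((y j)^-1 * poly_map (formal_comp Phi Psi) y j).
Proof.
move=> Phi1; elim: k => [|k [Psi Psi1 kPsi]].
  (* Term 0 of the series is all of [G], so any map with identity matrix will do. *)
  have [Psi Psi1] := formal_linear G (1%:M : 'M[int]_n)%R.
  by exists Psi.
pose Theta := formal_comp Phi Psi.
have Theta1 : exponent_matrix Theta = 1%:M%R.
  by rewrite exponent_matrix_comp Phi1 Psi1 mulmx1.
(* The error of [Theta] against the identity; its exponent sums vanish and its values lie in term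
   [k]. *)
pose e j := (fp_var G j)^-1 * Theta j.
have e0 j i : fp_expsum i (e j) = 0%R.
  have := congr1 (fun A : 'M[int]_n => A i j) Theta1; rewrite !mxE => Tij.
  by rewrite fp_expsumM fp_expsumV fp_expsumX Tij eq_sym addNr.
have eE (y : {ffun 'I_n -> G}) j :
    fp_lift idfun y (e j) = (y j)^-1 * poly_map Theta y j.
  by rewrite fp_liftM multiplicativeV /= fp_liftX [poly_map _ _ _]ffunE.
pose E : formal_poly_map G n := [ffun j => fp_var G j * (e j)^-1].
exists (formal_comp Psi E) => [|y j].
  rewrite exponent_matrix_comp Psi1 mulmx1; apply/matrixP=> i j.
  by rewrite !mxE ffunE fp_expsumM fp_expsumV e0 subr0 fp_expsumX eq_sym.
have -> : poly_map (formal_comp Phi (formal_comp Psi E)) y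
    = poly_map Theta (poly_map E y).
  by rewrite !poly_map_comp /= !poly_map_comp.
pose z i := (fp_lift idfun y (e i))^-1.
have EE : poly_map E y =1 (fun i => y i * z i).
  by move=> i; rewrite !ffunE fp_liftM multiplicativeV /= fp_liftX.
(* The new error is the quotient of two values of [e j], at [y] and at the corrected point, whose
   coordinates are [y i * z i]. *)
have -> : (y j)^-1 * poly_map Theta (poly_map E y) j
    = (fp_lift idfun y (e j))^-1 * fp_lift idfun (poly_map E y) (e j).
  by rewrite (eE (poly_map E y)) EE /z invgM invgK !mulgA mulVg mul1g.
have /funext -> := EE.
apply: fp_lift_mul_lower_central => // i; apply: lower_centralV.
by rewrite eE.
Qed.

Lemma unimodular_right_inverse Phi :
  nilpotent_group G -> formal_unimodular Phi ->
  exists2 Psi, formal_unimodular Psi & cancel (poly_map Psi) (poly_map Phi).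
Proof.
move=> [c Gc] uPhi; have uA : exponent_matrix Phi \in unitmx.
  by rewrite unitmxE; case: uPhi => ->.
(* The determinant is a unit of the integers, so the inverse matrix is integral. *)
have [L LE] := formal_linear G (invmx (exponent_matrix Phi)).
have uL : formal_unimodular L.
  by rewrite /formal_unimodular LE det_inv; case: uPhi => ->; auto.
have Phi1 : exponent_matrix (formal_comp Phi L) = 1%:M%R.
  by rewrite exponent_matrix_comp LE mulVmx.
have [Psi Psi1 cPsi] := formal_inverse_mod_lower_central c Phi1.
exists (formal_comp L Psi).
  by apply: formal_unimodular_comp => //; left; rewrite Psi1 det1.
move=> y; apply/ffunP=> j; apply: (mulgI (y j)^-1); rewrite mulVg.
by have := Gc _ (cPsi y j); rewrite !poly_map_comp /= poly_map_comp.
Qed.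

End Inverse.

Theorem mainTheorem3 (G : groupType) (n : nat)
    (Gamma : {ffun 'I_n -> G} -> {ffun 'I_n -> G}) :
  nilpotent_group G -> (0 < n)%N -> unimodular_map Gamma ->
  exists Delta : {ffun 'I_n -> G} -> {ffun 'I_n -> G},
    [/\ cancel Gamma Delta, cancel Delta Gamma & unimodular_map Delta].
Proof.
move=> nilG _ [Phi uPhi GammaE].
have [Psi uPsi PsiK] := unimodular_right_inverse nilG uPhi.
have [Chi _ ChiK] := unimodular_right_inverse nilG uPsi.
exists (poly_map Psi); split; last by exists Psi.
  (* [Chi] shows that [Psi] is surjective: with x as the image of [Chi x] under [Psi], the right
     inverse [Psi] of [Phi] is also a left inverse. *)
  by move=> x; rewrite GammaE -[x in LHS]ChiK PsiK ChiK.
by move=> x; rewrite GammaE PsiK.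
Qed.
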